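(* For every nonempty finite ordered set $A$, the family of monomials $\mathfrak{B}(A)$ is a basis of the vector space $\mathrm{As}^2(A)$.
   Context: Work over a field of characteristic zero. An $\mathrm{As}^2$-algebra is a (not necessarily unital) vector space with two bilinear operations $\star_1,\star_2$ such that each is associative, $(a\star_i b)\star_i c=a\star_i(b\star_i c)$ for $i=1,2$, and $$(a\star_1 b)\star_2 c+(a\star_2 b)\star_1 c=a\star_1 (b\star_2 c)+a\star_2 (b\star_1 c).$$ For a finite set $A$, $\mathrm{As}^2(A)$ denotes the multilinear part of the free $\mathrm{As}^2$-algebra generated by $A$, i.e. the span of all monomials in which each element of $A$ occurs exactly once. For a finite ordered set $A=\{a_1<a_2<\dots<a_n\}$, a family of monomials $\mathfrak{B}(A)$ in the free $\mathrm{As}^2$-algebra generated by $A$, together with a ''top level operation'' $t(b)\in\{1,2\}$ for each $b\in\mathfrak{B}(A)$, is defined recursively as follows. - If $A=\{a_1\}$, then $\mathfrak{B}(A)=\{a_1\}$ and $t(a_1)=1$. - If $n>1$, a monomial $b$ belongs to $\mathfrak{B}(A)$ if and only if one of the following holds: (1) $b=a_k\star_1 b'$ for some $1\le k\le n$ and $b'\in\mathfrak{B}(A\setminus\{a_k\})$; in this case $t(b)=1$; (2) $b=b_1\star_2 b_2$ with $b_1\in\mathfrak{B}(A_1)$, $b_2\in\mathfrak{B}(A_2)$ for some nonempty $A_1,A_2$ with $A_1\sqcup A_2=A$, and $t(b_1)=1$; in this case $t(b)=2$. *)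

(* Defs.v *)
From HB Require Import structures.
From mathcomp Require Import all_boot all_order all_algebra.
From mathcomp Require Import boolp.

Set Implicit Arguments.
Unset Strict Implicit.
Unset Printing Implicit Defensive.

Import GRing.Theory.
Local Open Scope ring_scope.
Local Open Scope quotient_scope.

(** * As^2-algebras *)

HB.mixin Record isAs2Algebra (K : fieldType) V & GRing.Lmodule K V := {
  star1 : V -> V -> V;
  star2 : V -> V -> V;
  star1_linearl : forall y, linear (star1^~ y);
  star1_linearr : forall x, linear (star1 x);
  star2_linearl : forall y, linear (star2^~ y);
  star2_linearr : forall x, linear (star2 x);
  star1A : forall a b c, star1 (star1 a b) c = star1 a (star1 b c);
  star2A : forall a b c, star2 (star2 a b) c = star2 a (star2 b c);
  star12_compat : forall a b c,
    star2 (star1 a b) c + star1 (star2 a b) c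
      = star1 a (star2 b c) + star2 a (star1 b c)
}.

#[short(type="as2AlgType")]
HB.structure Definition As2Algebra (K : fieldType) :=
  { V of isAs2Algebra K V & GRing.Lmodule K V }.

Definition as2_morph (K : fieldType) (V W : as2AlgType K)
    (phi : {linear V -> W}) : Prop :=
  (forall x y, phi (star1 x y) = star1 (phi x) (phi y)) /\
  (forall x y, phi (star2 x y) = star2 (phi x) (phi y)).

(** * The free As^2-algebra

    Quotient of the set of all formal expressions in the operations of an
    As^2-algebra by the congruence generated by the axioms of As^2-algebras;
    [free_As2_universal] below is the universal property. *)

Section FreeAs2.
Variables (K : fieldType) (A : Type).

Inductive expr : Type :=
| EGen of A
| EZero
| EAdd of expr & expr
| EScale of K & expr
| EMul1 of expr & expr
| EMul2 of expr & expr.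

Inductive eqv : expr -> expr -> Prop :=
| eqv_refl x : eqv x x
| eqv_sym x y : eqv x y -> eqv y x
| eqv_trans x y z : eqv x y -> eqv y z -> eqv x z
| eqv_add x x' y y' : eqv x x' -> eqv y y' -> eqv (EAdd x y) (EAdd x' y')
| eqv_scale k x x' : eqv x x' -> eqv (EScale k x) (EScale k x')
| eqv_mul1 x x' y y' : eqv x x' -> eqv y y' -> eqv (EMul1 x y) (EMul1 x' y')
| eqv_mul2 x x' y y' : eqv x x' -> eqv y y' -> eqv (EMul2 x y) (EMul2 x' y')
| eqv_addA x y z : eqv (EAdd x (EAdd y z)) (EAdd (EAdd x y) z)
| eqv_addC x y : eqv (EAdd x y) (EAdd y x)
| eqv_add0 x : eqv (EAdd EZero x) x
| eqv_addN x : eqv (EAdd (EScale (-1) x) x) EZero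
| eqv_scaleA k l x : eqv (EScale k (EScale l x)) (EScale (k * l) x)
| eqv_scale1 x : eqv (EScale 1 x) x
| eqv_scaleDr k x y :
    eqv (EScale k (EAdd x y)) (EAdd (EScale k x) (EScale k y))
| eqv_scaleDl k l x :
    eqv (EScale (k + l) x) (EAdd (EScale k x) (EScale l x))
| eqv_lin1l k x x' y : eqv (EMul1 (EAdd (EScale k x) x') y)
                           (EAdd (EScale k (EMul1 x y)) (EMul1 x' y))
| eqv_lin1r k x y y' : eqv (EMul1 x (EAdd (EScale k y) y'))
                           (EAdd (EScale k (EMul1 x y)) (EMul1 x y'))
| eqv_lin2l k x x' y : eqv (EMul2 (EAdd (EScale k x) x') y)
                           (EAdd (EScale k (EMul2 x y)) (EMul2 x' y))
| eqv_lin2r k x y y' : eqv (EMul2 x (EAdd (EScale k y) y'))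
                           (EAdd (EScale k (EMul2 x y)) (EMul2 x y'))
| eqv_mul1A x y z : eqv (EMul1 (EMul1 x y) z) (EMul1 x (EMul1 y z))
| eqv_mul2A x y z : eqv (EMul2 (EMul2 x y) z) (EMul2 x (EMul2 y z))
| eqv_compat x y z :
    eqv (EAdd (EMul2 (EMul1 x y) z) (EMul1 (EMul2 x y) z))
        (EAdd (EMul1 x (EMul2 y z)) (EMul2 x (EMul1 y z))).

HB.instance Definition _ := gen_eqMixin expr.
HB.instance Definition _ := gen_choiceMixin expr.

Definition eqvb : rel expr := fun x y => `[< eqv x y >].

Lemma eqvb_equiv : equiv_class_of eqvb.
Proof.
split=> [x|x y|y x z].
- exact/asboolP/eqv_refl.
- by apply/asboolP/asboolP; exact: eqv_sym.
- by move=> /asboolP xy /asboolP yz; apply/asboolP; exact: eqv_trans xy yz.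
Qed.

Canonical eqvb_rel := EquivRelPack eqvb_equiv.

Definition free_As2 : Type := {eq_quot eqvb_rel}.
HB.instance Definition _ := Choice.on free_As2.

Definition cls (e : expr) : free_As2 := \pi_({eq_quot eqvb_rel}) e.
Definition rep (x : free_As2) : expr := repr (x : {eq_quot eqvb_rel}).

Lemma repK x : cls (rep x) = x.
Proof. exact: reprK. Qed.

Lemma cls_eq e f : cls e = cls f <-> eqv e f.
Proof.
split=> [/eqP|ef]; last by apply/eqP; rewrite eqmodE; apply/asboolP.
by rewrite eqmodE => /asboolP.
Qed.

Lemma eqv_rep e : eqv (rep (cls e)) e.
Proof. by apply/cls_eq; rewrite repK. Qed.

Definition free_gen (a : A) : free_As2 := cls (EGen a).
Definition free_add (x y : free_As2) := cls (EAdd (rep x) (rep y)).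
Definition free_scale (k : K) (x : free_As2) := cls (EScale k (rep x)).
Definition free_star1 (x y : free_As2) := cls (EMul1 (rep x) (rep y)).
Definition free_star2 (x y : free_As2) := cls (EMul2 (rep x) (rep y)).

Lemma free_addE e f : free_add (cls e) (cls f) = cls (EAdd e f).
Proof. by apply/cls_eq/eqv_add; exact: eqv_rep. Qed.

Lemma free_scaleE k e : free_scale k (cls e) = cls (EScale k e).
Proof. by apply/cls_eq/eqv_scale; exact: eqv_rep. Qed.

Lemma free_star1E e f : free_star1 (cls e) (cls f) = cls (EMul1 e f).
Proof. by apply/cls_eq/eqv_mul1; exact: eqv_rep. Qed.

Lemma free_star2E e f : free_star2 (cls e) (cls f) = cls (EMul2 e f).
Proof. by apply/cls_eq/eqv_mul2; exact: eqv_rep. Qed.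

Let freeE := (free_addE, free_scaleE, free_star1E, free_star2E).

Lemma free_addA : associative free_add.
Proof.
move=> x y z; rewrite -(repK x) -(repK y) -(repK z) !freeE.
exact/cls_eq/eqv_addA.
Qed.

Lemma free_addC : commutative free_add.
Proof.
by move=> x y; rewrite -(repK x) -(repK y) !freeE; exact/cls_eq/eqv_addC.
Qed.

Lemma free_add0 : left_id (cls EZero) free_add.
Proof. by move=> x; rewrite -(repK x) !freeE; exact/cls_eq/eqv_add0. Qed.

Lemma free_addN : left_inverse (cls EZero) (free_scale (-1)) free_add.
Proof. by move=> x; rewrite -(repK x) !freeE; exact/cls_eq/eqv_addN. Qed.

HB.instance Definition _ :=
  GRing.isZmodule.Build free_As2 free_addA free_addC free_add0 free_addN.

Lemma free_scaleA k l x :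
  free_scale k (free_scale l x) = free_scale (k * l) x.
Proof. by rewrite -(repK x) !freeE; exact/cls_eq/eqv_scaleA. Qed.

Lemma free_scale1 : left_id 1 free_scale.
Proof. by move=> x; rewrite -(repK x) !freeE; exact/cls_eq/eqv_scale1. Qed.

Lemma free_scaleDr : right_distributive free_scale +%R.
Proof.
move=> k x y; rewrite -(repK x) -(repK y) /GRing.add /= !freeE.
exact/cls_eq/eqv_scaleDr.
Qed.

Lemma free_scaleDl x : {morph free_scale^~ x : k l / k + l}.
Proof.
move=> k l; rewrite -(repK x) [in RHS]/GRing.add /= !freeE.
exact/cls_eq/eqv_scaleDl.
Qed.

HB.instance Definition _ :=
  GRing.Zmodule_isLmodule.Build K free_As2
    free_scaleA free_scale1 free_scaleDr free_scaleDl.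

Lemma cls0 : cls EZero = 0. Proof. by []. Qed.

Lemma clsD e f : cls (EAdd e f) = cls e + cls f.
Proof. by rewrite -free_addE. Qed.

Lemma clsZ k e : cls (EScale k e) = k *: cls e.
Proof. by rewrite -free_scaleE. Qed.

Lemma free_star1_linearl y : linear (free_star1^~ y).
Proof.
move=> k x x'; rewrite -(repK x) -(repK x') -(repK y).
by rewrite -clsZ -clsD !freeE -clsZ -clsD; exact/cls_eq/eqv_lin1l.
Qed.

Lemma free_star1_linearr x : linear (free_star1 x).
Proof.
move=> k y y'; rewrite -(repK x) -(repK y) -(repK y').
by rewrite -clsZ -clsD !freeE -clsZ -clsD; exact/cls_eq/eqv_lin1r.
Qed.

Lemma free_star2_linearl y : linear (free_star2^~ y).
Proof.
move=> k x x'; rewrite -(repK x) -(repK x') -(repK y).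
by rewrite -clsZ -clsD !freeE -clsZ -clsD; exact/cls_eq/eqv_lin2l.
Qed.

Lemma free_star2_linearr x : linear (free_star2 x).
Proof.
move=> k y y'; rewrite -(repK x) -(repK y) -(repK y').
by rewrite -clsZ -clsD !freeE -clsZ -clsD; exact/cls_eq/eqv_lin2r.
Qed.

Lemma free_star1A x y z :
  free_star1 (free_star1 x y) z = free_star1 x (free_star1 y z).
Proof.
rewrite -(repK x) -(repK y) -(repK z) !freeE; exact/cls_eq/eqv_mul1A.
Qed.

Lemma free_star2A x y z :
  free_star2 (free_star2 x y) z = free_star2 x (free_star2 y z).
Proof.
rewrite -(repK x) -(repK y) -(repK z) !freeE; exact/cls_eq/eqv_mul2A.
Qed.

Lemma free_compat x y z :
  free_star2 (free_star1 x y) z + free_star1 (free_star2 x y) z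
    = free_star1 x (free_star2 y z) + free_star2 x (free_star1 y z).
Proof.
rewrite -(repK x) -(repK y) -(repK z) !freeE -!clsD.
exact/cls_eq/eqv_compat.
Qed.

HB.instance Definition _ :=
  isAs2Algebra.Build K free_As2
    free_star1_linearl free_star1_linearr
    free_star2_linearl free_star2_linearr
    free_star1A free_star2A free_compat.

Lemma cls1 e f : cls (EMul1 e f) = star1 (cls e) (cls f).
Proof. by rewrite -free_star1E. Qed.

Lemma cls2 e f : cls (EMul2 e f) = star2 (cls e) (cls f).
Proof. by rewrite -free_star2E. Qed.

Section Universal.
Variables (V : as2AlgType K) (f : A -> V).

Fixpoint expr_eval (e : expr) : V :=
  match e with
  | EGen a => f a
  | EZero => 0
  | EAdd x y => expr_eval x + expr_eval y
  | EScale k x => k *: expr_eval x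
  | EMul1 x y => star1 (expr_eval x) (expr_eval y)
  | EMul2 x y => star2 (expr_eval x) (expr_eval y)
  end.

Lemma expr_eval_eqv e e' : eqv e e' -> expr_eval e = expr_eval e'.
Proof.
elim=> //=; try by congruence.
- by move=> *; rewrite addrA.
- by move=> *; rewrite addrC.
- by move=> *; rewrite add0r.
- by move=> *; rewrite scaleN1r addNr.
- by move=> *; rewrite scalerA.
- by move=> *; rewrite scale1r.
- by move=> *; rewrite scalerDr.
- by move=> *; rewrite scalerDl.
- by move=> *; exact: star1_linearl.
- by move=> *; exact: star1_linearr.
- by move=> *; exact: star2_linearl.
- by move=> *; exact: star2_linearr.
- by move=> *; exact: star1A.
- by move=> *; exact: star2A.
- by move=> *; exact: star12_compat.
Qed.

Definition free_lift (x : free_As2) : V := expr_eval (rep x).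

Lemma free_liftE e : free_lift (cls e) = expr_eval e.
Proof. exact/expr_eval_eqv/eqv_rep. Qed.

Lemma free_lift_linear : linear free_lift.
Proof.
move=> k x y; rewrite -(repK x) -(repK y) -clsZ -clsD.
by rewrite !free_liftE.
Qed.

HB.instance Definition _ :=
  GRing.isLinear.Build K free_As2 V *:%R free_lift free_lift_linear.

Lemma free_As2_universal :
  [/\ as2_morph free_lift,
      forall a, free_lift (free_gen a) = f a
    & forall psi : {linear free_As2 -> V}, as2_morph psi ->
        (forall a, psi (free_gen a) = f a) -> psi =1 free_lift].
Proof.
split=> [|a|psi [psi1 psi2] psig x]; last 1 first.
- rewrite -(repK x); elim: (rep x) => [a||e He e' He'|k e He|e He e' He'|e He e' He'].
  + by rewrite psig free_liftE.
  + by rewrite cls0 !linear0.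
  + by rewrite clsD !linearD He He'.
  + by rewrite clsZ !linearZ He.
  + by rewrite cls1 psi1 He He' -cls1 !free_liftE.
  + by rewrite cls2 psi2 He He' -cls2 !free_liftE.
- by split=> x y; rewrite /= -(repK x) -(repK y) -?cls1 -?cls2 !free_liftE.
- by rewrite free_liftE.
Qed.

End Universal.
End FreeAs2.

(** * Monomials

    A monomial is represented by the formal bracketed word which defines it
    (so that its top level operation makes sense); [mon_val] is its value in
    the free As^2-algebra. *)

Section Monomials.
Variable A : Type.

Inductive monomial : Type :=
| Gen of A
| Mul1 of monomial & monomial
| Mul2 of monomial & monomial.

HB.instance Definition _ := gen_eqMixin monomial.
HB.instance Definition _ := gen_choiceMixin monomial.

Fixpoint letters (m : monomial) : seq A :=
  match m with
  | Gen a => [:: a]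
  | Mul1 l r => letters l ++ letters r
  | Mul2 l r => letters l ++ letters r
  end.

Definition top_op (m : monomial) : nat :=
  match m with
  | Gen _ => 1%N
  | Mul1 _ _ => 1%N
  | Mul2 _ _ => 2%N
  end.

Fixpoint mon_val (K : fieldType) (m : monomial) : free_As2 K A :=
  match m with
  | Gen a => free_gen K a
  | Mul1 l r => star1 (mon_val K l) (mon_val K r)
  | Mul2 l r => star2 (mon_val K l) (mon_val K r)
  end.

End Monomials.

(** [frakB S b]: the monomial [b] belongs to the family attached to the
    subset [S] of [A]. The order on [A] plays no role in the recursion. *)
Inductive frakB (A : finType) : {set A} -> monomial A -> Prop :=
| frakB_gen (a : A) : frakB [set a] (Gen a)
| frakB_mul1 (S : {set A}) (a : A) (b : monomial A) :
    (1 < #|S|)%N -> a \in S -> frakB (S :\ a) b -> frakB S (Mul1 (Gen a) b)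
| frakB_mul2 (S S1 S2 : {set A}) (b1 b2 : monomial A) :
    S1 != set0 -> S2 != set0 -> [disjoint S1 & S2] -> S1 :|: S2 = S ->
    frakB S1 b1 -> frakB S2 b2 -> top_op b1 = 1%N ->
    frakB S (Mul2 b1 b2).

(** * Bases

    For a family [f] indexed by the elements of [I] satisfying [P]. *)

Section Bases.
Variables (K : fieldType) (V : lmodType K) (I : eqType).
Variables (P : I -> Prop) (f : I -> V).

Definition in_span (v : V) : Prop :=
  exists (s : seq I) (c : I -> K),
    (forall i, i \in s -> P i) /\ v = \sum_(i <- s) c i *: f i.

Definition lin_indep : Prop :=
  forall (s : seq I) (c : I -> K),
    uniq s -> (forall i, i \in s -> P i) ->
    \sum_(i <- s) c i *: f i = 0 -> forall i, i \in s -> c i = 0.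

Definition is_basis (W : V -> Prop) : Prop :=
  lin_indep /\ (forall v, W v <-> in_span v).

End Bases.

(** The multilinear part As^2(A) of the free As^2-algebra on [A]. *)
Definition As2_multilinear (K : fieldType) (A : finType) :
    free_As2 K A -> Prop :=
  in_span (fun m : monomial A => forall a : A, count_mem a (letters m) = 1%N)
          (@mon_val A K).

(* Main.v *)
Require Import Defs.
From HB Require Import structures.
From mathcomp Require Import all_boot all_order all_algebra zify.

(** Read from left to right, the three defining identities are rewriting rules:
    [(a*b)*c] is rewritten for both operations, and [(a *2 b) *1 c] is replaced
    by [a *1 (b *2 c) + a *2 (b *1 c) - (a *1 b) *2 c].  The monomials which
    no rule rewrites are those where the left factor of a [*1] is a generator
    and the left factor of a [*2] is not itself a [*2]; among multilinear
    monomials they form the family B(A).  The rules terminate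
    ([mon_val_normal_span]), so B(A) spans.

    Independence is seen in concrete As^2-algebras of matrices.  Given a map
    [g] from the row indices to a circle, let [X *2 Y] be the matrix product
    and
      (X *1 Y) i j = sum_k w(i,k,j) X i k Y k j,
    where w(i,k,j) is 1 if g(i), g(k), g(j) are met in this order around the
    circle, and 0 otherwise.  Given four points i, j, k, l, a quadrangle is cut
    into two triangles in two ways, ijk + ikl and jkl + ijl, and the pairs of
    values of w on the two cuts have the same sum and the same product:
    equality of products makes [*1] associative ([cycA]), equality of sums
    makes it compatible with the matrix product ([cycD]).  (In other words
      X *1 Y = X N(Y) + N(X) Y - N(X Y),
    where N keeps the entries with g(i) <= g(j) and kills the others.)

    For a word x_0 ... x_(n-1), send x_i to the matrix unit E_(i,i+1).  Then a
    multilinear monomial has a nonzero entry at (0,n) only if its word is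
    x_0 ... x_(n-1), so that different words are separated.  A normal monomial
    is a planar forest whose vertices, in preorder, are its letters: [x *1 b]
    grafts the forest b on the root x, and [*2] is juxtaposition.  If d_i
    denotes the number of strict descendants of the i-th vertex, the entry at
    (0,n) is the product over i of w(i, i+1, i+1+d_i) ([eval_normal]), and the
    sequence (d_i) determines the monomial ([code_inj]).

    It remains to see that for distinct sequences (d_i) these products are
    independent as functions of g ([cyc_weight_indep]).  The point g(0) occurs
    only in the factor w(0,1,1+d_0).  When g(0) moves across a point g(1+d)
    with d > 0, only the products with d_0 = d change, and they change by the
    product of their remaining factors; when g(0) lies just after g(1), only
    the products with d_0 = 0 survive.  Hence a linear relation restricts to
    the sequences with a given d_0, with the first factor dropped, and
    induction applies. *)

Set Implicit Arguments.
Unset Strict Implicit.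
Unset Printing Implicit Defensive.

Import GRing.Theory.
Local Open Scope ring_scope.

(** * Spans of families *)

Section Spans.
Variables (K : fieldType) (V : lmodType K) (I : eqType).
Variables (P : I -> Prop) (f : I -> V).

Lemma span0 : in_span P f 0.
Proof. by exists [::], (fun _ => 0); rewrite big_nil. Qed.

Lemma span_gen i : P i -> in_span P f (f i).
Proof.
move=> Pi; exists [:: i], (fun _ => 1); rewrite big_seq1 scale1r.
by split=> // j; rewrite inE => /eqP->.
Qed.

(** In [in_span] the list of indices may have repetitions, while the
    coefficients depend on the index only; to add two combinations, both are
    first rewritten over a common duplicate-free list. *)
Lemma sum_count (s t : seq I) (F : I -> V) : uniq t -> {subset s <= t} ->
  \sum_(i <- s) F i = \sum_(i <- t) F i *+ count_mem i s.
Proof.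
move=> ut; elim: s => [|j s IHs] st /=.
  by rewrite big_nil big1.
rewrite big_cons IHs => [|i si]; last by rewrite st // inE si orbT.
under [RHS]eq_bigr => i _ do rewrite mulrnDr.
rewrite big_split /=; congr (_ + _).
rewrite (bigD1_seq j) ?st ?mem_head //= eqxx mulr1n.
by rewrite big1 ?addr0 // => i; rewrite eq_sym => /negbTE->.
Qed.

Lemma span_lin k u v :
  in_span P f u -> in_span P f v -> in_span P f (k *: u + v).
Proof.
move=> [s [c [Ps ->]]] [t [d [Pt ->]]].
exists (undup (s ++ t)),
  (fun i => k * c i *+ count_mem i s + d i *+ count_mem i t); split.
  by move=> i; rewrite mem_undup mem_cat => /orP[/Ps|/Pt].
have sub w : {subset w <= s ++ t} ->
    forall F : I -> V, \sum_(i <- w) F i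
      = \sum_(i <- undup (s ++ t)) F i *+ count_mem i w.
  move=> wst F; apply: sum_count (undup_uniq _) _ => i /wst.
  by rewrite mem_undup.
rewrite (sub s) => [|i si]; last by rewrite mem_cat si.
rewrite (sub t) => [|i ti]; last by rewrite mem_cat ti orbT.
rewrite scaler_sumr -big_split /=; apply: eq_bigr => i _.
by rewrite scalerDl -!scalerMnl !scalerMnr scalerA.
Qed.

Lemma span_ind (Q : V -> Prop) : Q 0 ->
    (forall k i v, P i -> Q v -> Q (k *: f i + v)) ->
  forall v, in_span P f v -> Q v.
Proof.
move=> Q0 QS v [s [c [Ps ->]]]; elim: s Ps => [|i s IHs] Ps.
  by rewrite big_nil.
rewrite big_cons; apply: QS; first by apply: Ps; rewrite mem_head.
by apply: IHs => j sj; apply: Ps; rewrite inE sj orbT.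
Qed.

End Spans.

Lemma span_image (K : fieldType) (V W : lmodType K) (I J : eqType)
    (P : I -> Prop) (f : I -> V) (Q : J -> Prop) (h : J -> W) (F : V -> W) :
    linear F -> (forall i, P i -> in_span Q h (F (f i))) ->
  forall v, in_span P f v -> in_span Q h (F v).
Proof.
move=> linF FPQ; apply: span_ind => [|k i v Pi Qv].
  by rewrite -(addNr 0) -scaleN1r linF scaleN1r addNr; exact: span0.
by rewrite linF; apply: span_lin => //; exact: FPQ.
Qed.

(** * Normal monomials span *)

Section Normal.
Variable A : eqType.

Fixpoint normal (b : monomial A) : bool :=
  match b with
  | Gen _ => true
  | Mul1 (Gen _) b' => normal b'
  | Mul1 _ _ => false
  | Mul2 l r => [&& top_op l == 1%N, normal l & normal r]
  end.

Definition normal_word (u : seq A) (b : monomial A) : Prop :=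
  normal b /\ letters b = u.

Variable K : fieldType.
Local Notation normal_span u := (in_span (normal_word u) (@mon_val A K)).

(** Only the spine of [b] is rewritten: [(l *2 r) *2 y = l *2 (r *2 y)]. *)
Lemma normal_star2 (b : monomial A) v y : normal b -> normal_span v y ->
  normal_span (letters b ++ v) (star2 (mon_val K b) y).
Proof.
(* The case where no rewriting is needed. *)
have top1 b' z w : normal b' -> top_op b' = 1%N -> normal_span w z ->
    normal_span (letters b' ++ w) (star2 (mon_val K b') z).
  move=> nb tb; apply: span_image; first exact: star2_linearr.
  move=> r [nr <-]; apply: (@span_gen _ _ _ _ _ (Mul2 b' r)).
  by split=> //=; rewrite nb nr tb.
elim: b v y => [a|l _ r _|l IHl r IHr] v y nb vy; [exact: top1..|].
move: nb => /and3P[/eqP tl nl nr] /=.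
by rewrite star2A -catA; apply: top1 => //; exact: IHr.
Qed.

Lemma span_star2 u v x y : normal_span u x -> normal_span v y ->
  normal_span (u ++ v) (star2 x y).
Proof.
move=> ux vy; move: x ux; apply: (@span_image _ _ _ _ _ _ _ _ _ (star2^~ y)).
  exact: star2_linearl.
by move=> b [nb <-]; exact: normal_star2.
Qed.

(** Structural induction on [b] suffices for termination, although the
    compatibility rule creates the new products [r *1 y] and [l *1 r]: their
    left factors are the subterms [r] and [l] of [b]. *)
Lemma normal_star1 (b : monomial A) v y : normal b -> normal_span v y ->
  normal_span (letters b ++ v) (star1 (mon_val K b) y).
Proof.
elim: b v y => [a|l IHl r IHr|l IHl r IHr] v y nb vy.
- move: y vy; apply: span_image; first exact: star1_linearr.
  by move=> r [nr <-]; apply: (@span_gen _ _ _ _ _ (Mul1 (Gen a) r)).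
- case: l IHl nb => // a IHl nb /=.
  by rewrite star1A; apply: (IHl) => //; exact: IHr.
move: nb => /and3P[/eqP tl nl nr] /=.
have -> : star1 (star2 (mon_val K l) (mon_val K r)) y =
    -1 *: star2 (star1 (mon_val K l) (mon_val K r)) y
    + (1 *: star1 (mon_val K l) (star2 (mon_val K r) y)
       + star2 (mon_val K l) (star1 (mon_val K r) y)).
  by rewrite scale1r -star12_compat scaleN1r addKr.
have ry : normal_span (letters r) (mon_val K r) by exact: span_gen.
apply: span_lin; first by apply: span_star2 vy; exact: IHl.
rewrite -catA; apply: span_lin.
  by apply: IHl => //; exact: normal_star2.
by apply: normal_star2 => //; exact: IHr.
Qed.

Lemma span_star1 u v x y : normal_span u x -> normal_span v y ->
  normal_span (u ++ v) (star1 x y).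
Proof.
move=> ux vy; move: x ux; apply: (@span_image _ _ _ _ _ _ _ _ _ (star1^~ y)).
  exact: star1_linearl.
by move=> b [nb <-]; exact: normal_star1.
Qed.

Lemma mon_val_normal_span (m : monomial A) :
  normal_span (letters m) (mon_val K m).
Proof.
elim: m => [a|l IHl r IHr|l IHl r IHr] /=.
- exact: (@span_gen _ _ _ _ _ (Gen a)).
- exact: span_star1.
- exact: span_star2.
Qed.

End Normal.

(** * Normal monomials as planar forests *)

Section Codes.
Variable A : eqType.

(** The sequence of the numbers of strict descendants, in preorder, of the
    vertices of the planar forest described by a normal monomial. *)
Fixpoint code (b : monomial A) : seq nat :=
  match b with
  | Gen _ => [:: 0%N]
  | Mul1 _ r => size (letters r) :: code r
  | Mul2 l r => code l ++ code r
  end.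

Lemma size_letters_gt0 (b : monomial A) : (0 < size (letters b))%N.
Proof. by elim: b => //= l Hl r Hr; rewrite size_cat addn_gt0 Hl. Qed.

Lemma size_code (b : monomial A) : normal b -> size (code b) = size (letters b).
Proof.
elim: b => [//|c _ r IHr nb|l IHl r IHr] /=.
  by rewrite IHr //; case: c nb.
by move=> /and3P[_ /IHl El /IHr Er]; rewrite !size_cat El Er.
Qed.

(** A normal monomial which is not a [*2] is a single tree, whose root
    is the ancestor of all the other letters. *)
Lemma head_code (b : monomial A) :
  normal b -> top_op b = 1%N -> size (letters b) = (head 0%N (code b)).+1.
Proof. by case: b => [|[]|]. Qed.

Lemma head_code_lt (l r : monomial A) : normal (Mul2 l r) ->
  size (letters l) = (head 0%N (code (Mul2 l r))).+1.
Proof.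
move=> /and3P[/eqP tl nl _]; rewrite (head_code nl tl) /=.
by have := size_letters_gt0 l; rewrite -size_code //; case: (code l).
Qed.

(** The length of the first tree is read off from the head of the code
    ([head_code], [head_code_lt]).  Comparing it with the total length tells
    [*1] from [*2], and in the latter case tells where to cut the word and the
    code. *)
Lemma code_inj (b b' : monomial A) : normal b -> normal b' ->
  letters b = letters b' -> code b = code b' -> b = b'.
Proof.
(* On a given word, the head of the code is maximal for a single tree only. *)
have top_sep (c l r : monomial A) : normal c -> top_op c = 1%N ->
    normal (Mul2 l r) -> letters c = letters (Mul2 l r) ->
    code c = code (Mul2 l r) -> False.
  move=> nc tc nlr E C; have := head_code nc tc; rewrite E C -head_code_lt //=.
  rewrite size_cat => /eqP; rewrite -[X in _ == X]addn0 eqn_add2l.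
  by apply/negP; rewrite -lt0n size_letters_gt0.
have gen_sep a (l r : monomial A) :
    [:: a] = letters l ++ letters r -> False.
  have := size_letters_gt0 l; have := size_letters_gt0 r.
  by move=> ? ? /(congr1 size); rewrite /= size_cat; lia.
elim: b b' => [a|c _ r IHr|l IHl r IHr] b' nb.
- case: b' => [a' _ [->]//|l' r' nb'|l' r' nb' E C].
    by move=> E _; case: (gen_sep _ _ _ E).
  by case: (top_sep _ _ _ nb _ nb' E C).
- case: b' => [a'|c' r'|l' r' nb' E C].
  + by move=> _ E; case: (gen_sep _ _ _ (esym E)).
  + case: c nb => // a nr; case: c' => // a' nr' [-> Er] [_ Cr].
    by rewrite (IHr r' nr nr' Er Cr).
  by case: (top_sep _ _ _ nb _ nb' E C).
case: b' => [a' nb' E C|c' r' nb' E C|l' r' nb' E C].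
- by case: (top_sep _ _ _ nb' _ nb (esym E) (esym C)).
- by case: (top_sep _ _ _ nb' _ nb (esym E) (esym C)).
have sl : size (letters l) = size (letters l').
  by rewrite (head_code_lt nb) (head_code_lt nb') C.
move: nb nb' => /and3P[_ nl nr] /and3P[_ nl' nr'].
move/eqP: E; rewrite /= eqseq_cat // => /andP[/eqP El /eqP Er].
move/eqP: C; rewrite /= eqseq_cat ?size_code // => /andP[/eqP Cl /eqP Cr].
by rewrite (IHl l' nl nl' El Cl) (IHr r' nr nr' Er Cr).
Qed.

End Codes.

(** * Cyclic orientation and the matrix models *)

Section CyclicOrientation.
Variable g : nat -> nat.

(** [cyc i j k] says that [g i], [g j], [g k] are met in this order around the
    circle obtained by closing up the line: with [L i j] standing for
    [g i <= g j] as 0 or 1, it is [L i j + L j k - L i k], which is always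
    0 or 1. *)
Definition cyc (i j k : nat) : bool :=
  if (g i <= g k)%N then (g i <= g j)%N && (g j <= g k)%N
  else (g i <= g j)%N || (g j <= g k)%N.

Lemma cycA i j k l : cyc i j k && cyc i k l = cyc j k l && cyc i j l.
Proof. by rewrite /cyc; do 6!(case: leqP => ? //=); lia. Qed.

Lemma cycD i j k l : (cyc i j k + cyc i k l = cyc j k l + cyc i j l)%N.
Proof. by rewrite /cyc; do 6!(case: leqP => ? //=); lia. Qed.

(** Because of this value the leaves of a forest contribute the factor 1. *)
Lemma cyc_diag i j : cyc i j j.
Proof. by rewrite /cyc leqnn orbT andbT; case: ifP. Qed.

End CyclicOrientation.

Section Model.
Variables (K : fieldType) (N : nat).

(** The argument [g] does not change the matrices but selects the structure of
    As^2-algebra, which depends on [g] through [cyc_star1]. *)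
Definition cyc_mx of (nat -> nat) : Type := 'M[K]_N.

Variable g : nat -> nat.

HB.instance Definition _ := GRing.Lmodule.on (cyc_mx g).


Definition cyc_star1 (X Y : cyc_mx g) : cyc_mx g :=
  \matrix_(i, j) \sum_k (X i k * Y k j) *+ cyc g i k j.
Definition cyc_star2 (X Y : cyc_mx g) : cyc_mx g := mulmx X Y.

Lemma cyc_star1_linearl Y : linear (cyc_star1^~ Y).
Proof.
move=> a X X'; apply/matrixP=> i j; rewrite !mxE mulr_sumr -big_split.
by apply: eq_bigr => k _ /=; rewrite !mxE mulrDl mulrnDl -mulrA mulrnAr.
Qed.

Lemma cyc_star1_linearr X : linear (cyc_star1 X).
Proof.
move=> a Y Y'; apply/matrixP=> i j; rewrite !mxE mulr_sumr -big_split.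
by apply: eq_bigr => k _ /=; rewrite !mxE mulrDr mulrnDl mulrCA mulrnAr.
Qed.

Lemma cyc_star2_linearl Y : linear (cyc_star2^~ Y).
Proof. by move=> a X X'; rewrite /cyc_star2 mulmxDl -scalemxAl. Qed.

Lemma cyc_star2_linearr X : linear (cyc_star2 X).
Proof. by move=> a Y Y'; rewrite /cyc_star2 mulmxDr -scalemxAr. Qed.

Lemma cyc_star1A X Y Z :
  cyc_star1 (cyc_star1 X Y) Z = cyc_star1 X (cyc_star1 Y Z).
Proof.
apply/matrixP=> i j; rewrite !mxE.
under eq_bigr => k _ do rewrite mxE mulr_suml -sumrMnl.
under [RHS]eq_bigr => k _ do rewrite mxE mulr_sumr -sumrMnl.
rewrite exchange_big; apply: eq_bigr => k _; apply: eq_bigr => l _ /=.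
by rewrite mulrnAl mulrnAr mulrA -!mulrnA !mulnb cycA.
Qed.

Lemma cyc_star2A X Y Z :
  cyc_star2 (cyc_star2 X Y) Z = cyc_star2 X (cyc_star2 Y Z).
Proof. by rewrite /cyc_star2 mulmxA. Qed.

Lemma cyc_compat X Y Z :
  cyc_star2 (cyc_star1 X Y) Z + cyc_star1 (cyc_star2 X Y) Z
    = cyc_star1 X (cyc_star2 Y Z) + cyc_star2 X (cyc_star1 Y Z).
Proof.
apply/matrixP=> i j; rewrite !mxE -!big_split /=.
under eq_bigr => k _ do
  rewrite !mxE !mulr_suml -sumrMnl -big_split /=.
under [RHS]eq_bigr => k _ do
  rewrite !mxE !mulr_sumr -sumrMnl -big_split /=.
rewrite exchange_big; apply: eq_bigr => k _; apply: eq_bigr => l _ /=.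
by rewrite mulrnAl mulrnAr mulrA -!mulrnDr cycD addnC.
Qed.

HB.instance Definition _ :=
  isAs2Algebra.Build K (cyc_mx g)
    cyc_star1_linearl cyc_star1_linearr
    cyc_star2_linearl cyc_star2_linearr
    cyc_star1A cyc_star2A cyc_compat.

End Model.

(** The value at [g] of the function attached to the forest of code [t] when
    its vertices are placed at the steps [p -> p+1], [p+1 -> p+2], and so on. *)
Fixpoint cyc_weight (g : nat -> nat) (t : seq nat) (p : nat) : bool :=
  if t is d :: t' then cyc g p p.+1 (p.+1 + d)%N && cyc_weight g t' p.+1
  else true.

Lemma cyc_weight_cat g t t' p :
  cyc_weight g (t ++ t') p = cyc_weight g t p && cyc_weight g t' (p + size t)%N.
Proof.
elim: t p => [|d t IHt] p /=; first by rewrite addn0.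
by rewrite IHt andbA -addSnnS.
Qed.

Section Evaluation.
Variables (K : fieldType) (A : eqType) (w : nat -> A) (N : nat) (g : nat -> nat).

(** Each letter is sent to the sum of the matrix units [E_(i,i+1)] over its
    occurrences in the word [w]. *)
Definition path_mx (a : A) : cyc_mx K N g :=
  \matrix_(i, j) ((j == i.+1 :> nat) && (a == w i))%:R.

Definition occurs (u : seq A) (i j : nat) : bool :=
  (j == i + size u)%N && (u == map w (iota i (size u))).

(** A word factors through a unique intermediate position: this is why the sums
    in the matrix products below have at most one nonzero term. *)
Lemma occurs_cat u v i j :
  occurs (u ++ v) i j = occurs u i (i + size u)%N && occurs v (i + size u)%N j.
Proof.
rewrite /occurs eqxx size_cat iotaD map_cat eqseq_cat ?size_map ?size_iota //.
by rewrite addnA andbCA.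
Qed.

Lemma sum_indicator (h : nat -> bool) (m : nat) : (h m -> (m < N)%N) ->
  \sum_(k < N) ((k == m :> nat) && h k)%:R = (h m)%:R :> K.
Proof.
move=> hmN; case: (boolP (m < N)%N) => [mN|Nm].
  rewrite (bigD1 (Ordinal mN)) //= eqxx big1 ?addr0 // => k km.
  by rewrite (_ : (k == m :> nat) = false) //; apply/negbTE.
rewrite big1 => [|k _]; first by case: (h m) hmN Nm => // ->.
by case: eqP => //= km; rewrite -km ltn_ord in Nm.
Qed.

Lemma eval_normal (b : monomial A) (i j : 'I_N) : normal b ->
  free_lift path_mx (mon_val K b) i j
    = (occurs (letters b) i j && cyc_weight g (code b) i)%:R.
Proof.
have [[free_lift1 free_lift2] _ _] := free_As2_universal path_mx.
have lift1 x y : free_lift path_mx (star1 x y)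
    = cyc_star1 (free_lift path_mx x) (free_lift path_mx y).
  exact: free_lift1.
have lift2 x y : free_lift path_mx (star2 x y)
    = cyc_star2 (free_lift path_mx x) (free_lift path_mx y).
  exact: free_lift2.
have lift_gen a : free_lift path_mx (free_gen K a) = path_mx a.
  exact: free_liftE.
have occurs_le u k l : occurs u k l -> (k <= l)%N.
  by case/andP=> /eqP-> _; exact: leq_addr.
elim: b i j => [a|c _ r IHr|l IHl r IHr] i j nb.
- rewrite /= lift_gen mxE /occurs /= addn1 eqseq_cons andbT addn0.
  by rewrite cyc_diag !andbT.
- case: c nb => // a nr; rewrite /= lift1 lift_gen mxE.
  (* The whole summand, except for the condition that pins [k] to [i.+1]. *)
  pose h k := [&& a == w i, occurs (letters r) k j, cyc_weight g (code r) k
                & cyc g i k j].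
  rewrite (eq_bigr (fun k : 'I_N => ((k == i.+1 :> nat) && h k)%:R)); last first.
    move=> k _; rewrite mxE IHr // -natrM mulnb -mulrnA mulnb /h.
    by rewrite -!andbA.
  rewrite sum_indicator => [|/and3P[_ /occurs_le rj _]]; last first.
    exact: leq_ltn_trans rj (ltn_ord j).
  have occurs1 : occurs [:: a] i i.+1 = (a == w i).
    by rewrite /occurs /= addn1 eqxx eqseq_cons andbT.
  rewrite -cat1s occurs_cat /h /= addn1 occurs1.
  case: (a == w i) => //=; case: (boolP (occurs _ _ _)) => //= /andP[/eqP-> _].
  by rewrite andbC.
case/and3P: nb => _ nl nr; rewrite /= lift2 mxE.
pose m := (i + size (letters l))%N.
pose h k := [&& occurs (letters l) i m, cyc_weight g (code l) i,
                occurs (letters r) k j & cyc_weight g (code r) k].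
rewrite (eq_bigr (fun k : 'I_N => ((k == m :> nat) && h k)%:R)); last first.
  move=> k _; rewrite IHl // IHr // -natrM mulnb /h {1 3}/occurs eqxx /=.
  by rewrite -!andbA.
rewrite sum_indicator => [|/and4P[_ _ /occurs_le rj _]]; last first.
  exact: leq_ltn_trans rj (ltn_ord j).
by rewrite occurs_cat cyc_weight_cat size_code // /h andbACA -!andbA.
Qed.

End Evaluation.

(** * Independence of the products of orientations *)

Section Separation.

(** Doubling makes room between any two values of [g]: an even [x] is then
    different from all the values away from [p]. *)
Definition insert_at (g : nat -> nat) (p x : nat) : nat -> nat :=
  fun v => if v == p then x else (g v).*2.+1.

Lemma insert_at_inj g p x :
  injective g -> ~~ odd x -> injective (insert_at g p x).
Proof.
move=> gI ex u v; rewrite /insert_at.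
case: eqP => [->|_]; case: eqP => [->|_] // E; last by apply: gI; lia.
  by move: ex; rewrite E /= odd_double.
by move: ex; rewrite -E /= odd_double.
Qed.

Lemma cyc_weight_insert g p x t q : (p < q)%N ->
  cyc_weight (insert_at g p x) t q = cyc_weight g t q.
Proof.
elim: t q => //= d t IHt q pq; rewrite IHt; last by lia.
congr andb; rewrite /cyc /insert_at.
have -> : (q == p) = false by lia.
have -> : (q.+1 == p) = false by lia.
have -> : (q.+1 + d == p)%N = false by lia.
by rewrite !ltnS !leq_double.
Qed.

(** Just after [g p.+1] on the circle, [p] meets every other point before
    coming back to [p.+1]. *)
Lemma insert_after_first g p e : injective g ->
  cyc (insert_at g p (g p.+1).*2.+2) p p.+1 (p.+1 + e)%N = (e == 0%N).
Proof.
move=> gI; rewrite /cyc /insert_at eqxx.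
have -> : (p.+1 == p) = false by lia.
have -> : (p.+1 + e == p)%N = false by lia.
case: e => [|e]; first by rewrite addn0 ltnn; lia.
have : g p.+1 <> g (p.+1 + e.+1)%N by move=> /gI; lia.
by case: ifP; lia.
Qed.

(** As [p] moves across the point [p.+1 + d], only the orientations of the
    triangles having both as vertices can change. *)
Lemma insert_across g p d e : injective g -> (0 < d)%N ->
  cyc (insert_at g p (g (p.+1 + d)%N).*2.+2) p p.+1 (p.+1 + e)%N =
  (cyc (insert_at g p (g (p.+1 + d)%N).*2) p p.+1 (p.+1 + e)%N + (e == d))%N
    :> nat.
Proof.
move=> gI d0; rewrite /cyc /insert_at eqxx.
have -> : (p.+1 == p) = false by lia.
have -> : (p.+1 + e == p)%N = false by lia.
have N1 : g p.+1 <> g (p.+1 + d)%N by move=> /gI; lia.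
case: (e =P d) => [->|ed]; first by do 2!case: ifP; lia.
have : g (p.+1 + e)%N <> g (p.+1 + d)%N by move=> /gI; lia.
by do 2!case: ifP; lia.
Qed.

Variable K : fieldType.

(** The statement is about a family [f] of codes rather than a set of codes,
    so that the induction can drop the first entry of the codes without
    re-indexing the coefficients. *)
Lemma cyc_weight_indep (I : eqType) (n : nat) (s : seq I) (f : I -> seq nat)
    (c : I -> K) (p : nat) :
    uniq s -> {in s &, injective f} -> {in s, forall i, size (f i) = n} ->
    (forall g, injective g ->
      \sum_(i <- s) c i *+ cyc_weight g (f i) p = 0) ->
  {in s, forall i, c i = 0}.
Proof.
elim: n s f p => [|n IHn] s f p us fI fn sum0 i si.
  have := sum0 id (fun _ _ => id); rewrite (bigD1_seq i) //= big_seq_cond big1.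
    by rewrite (size0nil (fn i si)) mulr1n addr0.
  move=> j /andP[sj ji]; case/eqP: ji; apply: fI => //.
  by rewrite (size0nil (fn i si)) (size0nil (fn j sj)).
pose d := head 0%N (f i).
have fE j : j \in s -> f j = head 0%N (f j) :: behead (f j).
  by move=> /fn; case: (f j).
(* The part of the relation carried by the codes with the same head as [f i]
   will be shown to vanish after removing the heads. *)
pose sd := [seq j <- s | head 0%N (f j) == d].
apply: (IHn sd (fun j => behead (f j)) p.+1); last 1 first.
- by rewrite mem_filter eqxx.
- exact: filter_uniq.
- move=> j k; rewrite !mem_filter => /andP[/eqP jd sj] /andP[/eqP kd sk] E.
  by apply: fI => //; rewrite fE // [RHS]fE // jd kd E.
- by move=> j; rewrite mem_filter => /andP[_ /fn]; case: (f j) => //= ? ? [].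
move=> g gI; rewrite big_filter big_mkcond /=.
pose h x := insert_at g p x.
have hI x : injective (h x.*2) by apply: insert_at_inj; rewrite ?odd_double.
have sumE x : \sum_(j <- s) c j *+
    (cyc (h x.*2) p p.+1 (p.+1 + head 0%N (f j))%N
      && cyc_weight g (behead (f j)) p.+1) = 0.
  rewrite -[RHS](sum0 _ (hI x)) big_seq [RHS]big_seq; apply: eq_bigr => j sj.
  by rewrite [in RHS]fE //= cyc_weight_insert.
case: (posnP d) => [d0|d_gt0].
  (* For [d = 0] there is no position of [p] on the other side of [p.+1] to
     subtract; a single position of [p] kills all the other heads. *)
  rewrite -[RHS](sumE (g p.+1).+1); apply: eq_bigr => j _.
  by rewrite doubleS insert_after_first // d0; case: eqP.
have diff0 := congr2 (fun x y : K => x - y)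
  (sumE (g (p.+1 + d)%N).+1) (sumE (g (p.+1 + d)%N)).
apply: etrans (etrans diff0 (subrr 0)); rewrite -sumrB; apply: eq_bigr => j _.
rewrite doubleS -!mulnb insert_across // mulnDl mulrnDr addrAC subrr add0r.
by case: eqP; rewrite ?mul1n ?mul0n.
Qed.

End Separation.

(** * The family B(A) *)

Section Family.
Variable A : finType.

Lemma frakBP (S : {set A}) (b : monomial A) :
  frakB S b <-> [/\ normal b, uniq (letters b) & [set x in letters b] = S].
Proof.
split=> [|[]].
  elim=> {S b} [a|S a b _ aS _ [nb ub Eb]|S S1 S2 l r _ _ dS <-].
  - by split=> //; apply/setP=> x; rewrite !inE.
  - split=> //=.
      by have := setD11 a S; rewrite -Eb inE => ->.
    by rewrite set_cons Eb setD1K.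
  move=> _ [nl ul El] _ [nr ur Er] tl; split=> /=.
  - by rewrite tl nl nr.
  - rewrite cat_uniq ul ur andbT; apply/hasPn=> x xr.
    have xS2 : x \in S2 by rewrite -Er inE.
    by have := disjointFl dS xS2; rewrite -El inE => /negbT.
  - by apply/setP=> x; rewrite -El -Er !inE mem_cat.
have neq0 (c : monomial A) : [set x in letters c] != set0.
  have := size_letters_gt0 c; case: (letters c) => // x u _.
  by apply/set0Pn; exists x; rewrite !inE eqxx.
elim: b S => [a|c _ r IHr|l IHl r IHr] S nb ub <-.
- suff -> : [set x in letters (Gen a)] = [set a] by exact: frakB_gen.
  by apply/setP=> x; rewrite !inE.
- case: c nb ub => // a nr /= /andP[ar ur]; rewrite set_cons.
  have a_r : a \notin [set x in letters r] by rewrite inE.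
  apply: frakB_mul1; rewrite ?setU11 ?setU1K //; last exact: IHr.
  by rewrite cardsU1 a_r ltnS card_gt0 neq0.
case/and3P: nb => /eqP tl nl nr.
move: ub; rewrite /= cat_uniq => /and3P[ul /hasPn dlr ur].
apply: (@frakB_mul2 _ _ [set x in letters l] [set x in letters r]) => //.
- rewrite disjoint_sym; apply/pred0P=> x /=; rewrite !inE.
  by apply/negbTE; rewrite negb_and -implybE; apply/implyP=> /dlr.
- by apply/setP=> x; rewrite !inE mem_cat.
- exact: IHl.
- exact: IHr.
Qed.

Lemma multilinearP (m : monomial A) :
  (forall a : A, count_mem a (letters m) = 1%N) <->
  uniq (letters m) /\ [set x in letters m] = [set: A].
Proof.
split=> [cm|[um Em] a].
  have min a : a \in letters m by rewrite -has_pred1 has_count cm.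
  split; last by apply/setP=> a; rewrite !inE min.
  by apply: count_mem_uniq => a; rewrite cm min.
have : a \in [set x in letters m] by rewrite Em inE.
by rewrite count_uniq_mem // inE => ->.
Qed.

Variable K : fieldType.

(** The letters are the same in all the monomials of the relation, but their
    orders vary; the model built on the word of [b] kills the monomials with a
    different word. *)
Lemma frakB_indep (S : {set A}) : lin_indep (frakB S) (@mon_val A K).
Proof.
move=> s c us sB sum0 b sb.
have [nb ub Sb] := (frakBP S b).1 (sB b sb).
pose u := letters b; pose n := size u.
have size_s b' : b' \in s -> size (letters b') = n.
  move=> /sB/frakBP[_ ub' Sb']; apply: perm_size; apply: uniq_perm => // x.
  by have /setP/(_ x) := etrans Sb' (esym Sb); rewrite !inE.
pose su := [seq b' <- s | letters b' == u].
have subsu b' : b' \in su -> [/\ normal b', letters b' = u & b' \in s].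
  rewrite mem_filter => /andP[/eqP-> sb'].
  by have [] := (frakBP S b').1 (sB _ sb').
apply: (@cyc_weight_indep K _ n su (@code A) c 0).
- exact: filter_uniq.
- move=> b1 b2 /subsu[n1 u1 _] /subsu[n2 u2 _].
  by apply: code_inj; rewrite // u1 u2.
- by move=> b' /subsu[nb' ub' _]; rewrite size_code // ub'.
- move=> g _; have a0 : A by elim: (b).
  pose f := path_mx K (nth a0 u) n.+1 g.
  pose ev : {linear free_As2 K A -> cyc_mx K n.+1 g} := free_lift f.
  have := congr1 (fun X : cyc_mx K n.+1 g => X ord0 ord_max)
            (congr1 (fun x => ev x) sum0).
  rewrite /= linear_sum linear0 summxE mxE => sumE.
  rewrite -[RHS]sumE big_filter big_mkcond big_seq [RHS]big_seq.
  apply: eq_bigr => b' sb'; have [nb' _ _] := (frakBP S b').1 (sB _ sb').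
  rewrite linearZ mxE (eval_normal K (nth a0 u) g) // /occurs size_s // eqxx /=.
  rewrite -/(mkseq _ _) mkseq_nth.
  by case: eqP; rewrite ?mulr0 // mulr_natr.
by rewrite mem_filter eqxx.
Qed.

Lemma multilinear_frakB (v : free_As2 K A) :
  As2_multilinear v <-> in_span (frakB [set: A]) (@mon_val A K) v.
Proof.
split; apply: (@span_image _ _ _ _ _ _ _ _ _ id) => // m.
  move=> /multilinearP[um Em].
  apply: (@span_image _ _ _ _ _ _ _ _ _ id) (mon_val_normal_span K m) => //.
  move=> b [nb ub]; apply: span_gen; apply/frakBP.
  by rewrite ub; split.
by move=> /frakBP[_ um Em]; apply: span_gen; apply/multilinearP.
Qed.

End Family.

Theorem theorem3 (K : fieldType) (charK0 : [pchar K]%R =i pred0)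
    (d : Order.disp_t) (A : finOrderType d) (A_nonempty : (0 < #|A|)%N) :
  is_basis (frakB [set: A]) (@mon_val A K) (@As2_multilinear K A).
Proof. by split; [exact: frakB_indep | exact: multilinear_frakB]. Qed.
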